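(* Let $n=\prod_{i\leqslant \omega(n)} q_i^{a_i}\geqslant 2$ be an integer, where $q_1<q_2<\dots<q_{\omega(n)}$ are its distinct prime divisors and $a_i\geqslant 1$ their multiplicities. For integers $k\geqslant 1$ and $q\geqslant 2$ define $$M(k)=\exp\!\left(e^{-\gamma} f(N_k)\right)-\log N_k,\qquad M_k(q)=1+\frac{M(k)}{\log q}.$$ If for some $i\leqslant \omega(n)$ we have $a_i\geqslant M_{\omega(n)}(q_i)$, then $n$ satisfies Robin's inequality $s(n)<e^{\gamma}\log\log n$ (regardless of the multiplicities of the other prime divisors).
   Context: $\omega(n)$ is the number of distinct primes dividing $n$; $\sigma(n)=\sum_{d\mid n} d$; $s(n)=\sigma(n)/n$; $f(n)=n/\varphi(n)$ with $\varphi$ Euler's totient; $p_i$ is the $i$-th prime; $N_k=\prod_{j\leqslant k}p_j$ is the $k$-th primorial; $\gamma$ is Euler's constant. *)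

(* Defs.v *)
From HB Require Import structures.
From mathcomp Require Import all_boot all_order all_algebra.
From mathcomp Require Import all_classical all_reals all_analysis.

Set Implicit Arguments.
Unset Strict Implicit.
Unset Printing Implicit Defensive.

Import Order.TTheory GRing.Theory Num.Theory.
Import numFieldNormedType.Exports.

Local Open Scope ring_scope.

Definition omega (n : nat) : nat := size (primes n).

Definition sigma (n : nat) : nat := (\sum_(d <- divisors n) d)%N.

Lemma next_prime_ex (m : nat) : exists p, (m < p)%N && prime p.
Proof. by have [p mp pp] := prime_above m; exists p; rewrite mp pp. Qed.

(* The smallest prime greater than m. *)
Definition next_prime (m : nat) : nat := ex_minn (next_prime_ex m).

(* Indexed from 1: nth_prime 1 = 2, nth_prime 2 = 3, nth_prime 3 = 5; the value
   nth_prime 0 = 0 is only the seed of the iteration. *)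
Definition nth_prime (i : nat) : nat := iter i next_prime 0%N.

Definition primorial (k : nat) : nat := (\prod_(1 <= j < k.+1) nth_prime j)%N.

Section RealValued.
Variable R : realType.

(* [series harmonic n] is 1 + 1/2 + ... + 1/n. *)
Definition euler_gamma : R :=
  limn (fun n : nat => series (@harmonic R) n - ln n%:R).

Definition s (n : nat) : R := (sigma n)%:R / n%:R.

Definition f (n : nat) : R := n%:R / (totient n)%:R.

Definition M (k : nat) : R :=
  expR (expR (- euler_gamma) * f (primorial k)) - ln (primorial k)%:R.

Definition Mq (k q : nat) : R := 1 + M k / ln q%:R.

Definition robin (n : nat) : Prop := s n < expR euler_gamma * ln (ln n%:R).

End RealValued.

(* Main.v *)
(** For [d %| n] the product formula gives f(d) <= f(n), that is
    d phi(n) <= n phi(d); summing over the divisors and using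
    sum_(d %| n) phi(d) = n yields s(n) < f(n) for n >= 2.  Since the i-th
    prime divisor of n is at least the i-th prime, with k = omega(n) we get
    f(n) <= f(N_k) and n >= N_k q_i^(a_i - 1).  The hypothesis on a_i turns the
    latter into log n >= exp(e^-gamma f(N_k)), i.e.
    e^gamma log log n >= f(N_k) >= f(n) > s(n). *)
Require Import Defs.
From HB Require Import structures.
From mathcomp Require Import all_boot all_order all_algebra all_solvable.
From mathcomp Require Import all_classical all_reals all_analysis.

Set Implicit Arguments.
Unset Strict Implicit.
Unset Printing Implicit Defensive.

Import Order.TTheory GRing.Theory Num.Theory.
Local Open Scope ring_scope.

Lemma next_primeP m : (m < next_prime m)%N /\ prime (next_prime m).
Proof. by rewrite /next_prime; case: ex_minnP => p /andP[]. Qed.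

Lemma next_prime_le m p : (m < p)%N -> prime p -> (next_prime m <= p)%N.
Proof.
by rewrite /next_prime; case: ex_minnP => r _ rmin mp pp; apply: rmin; rewrite mp.
Qed.

Lemma nth_prime_prime i : prime (nth_prime i.+1).
Proof. exact: (next_primeP _).2. Qed.

(** Each entry is a prime above its predecessor, hence above the previous [nth_prime], and
    [next_prime] is minimal; the induction starts from the seed 0. *)
Lemma nth_prime_le_nth (l : seq nat) i : sorted ltn l -> all prime l ->
  (i < size l)%N -> (nth_prime i.+1 <= nth 0%N l i)%N.
Proof.
move=> ls lp; elim: i => [|i IH] il; apply: next_prime_le.
- by apply/prime_gt0/(all_nthP _ lp).
- exact/(all_nthP _ lp).
- apply: leq_ltn_trans (IH (ltnW il)) _.
  by rewrite (sorted_ltn_nth ltn_trans 0%N ls) ?inE // ltnW.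
- exact/(all_nthP _ lp).
Qed.

(** Two strictly increasing lists with the same members coincide. *)
Lemma primes_prod (l : seq nat) : sorted ltn l -> all prime l ->
  primes (\prod_(p <- l) p)%N = l.
Proof.
move=> ls lp; apply: (irr_sorted_eq ltn_trans ltnn) => //; first exact: sorted_primes.
elim: l lp {ls} => [|p l IH] /=; first by rewrite big_nil.
case/andP=> pp lp x; rewrite big_cons primesM ?(prime_gt0 pp) //; last first.
  by rewrite big_seq prodn_cond_gt0 // => r /(allP lp)/prime_gt0.
by rewrite IH // primes_prime // !inE.
Qed.

Lemma sorted_nth_prime k : sorted ltn [seq nth_prime i | i <- iota 1 k].
Proof.
rewrite sorted_map; apply: (sub_sorted (e := fun x y => y == x.+1)) => /=.
  by move=> x _ /eqP ->; exact: (next_primeP _).1.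
by elim: k 1%N => [|[|k] IH] m //=; rewrite eqxx; exact: IH.
Qed.

Lemma primes_primorial k :
  primes (primorial k) = [seq nth_prime i | i <- iota 1 k].
Proof.
rewrite /primorial /index_iota subSS subn0.
rewrite -(big_map nth_prime xpredT (fun p => p)).
apply: primes_prod (sorted_nth_prime k) _.
by apply/allP => p /mapP[[|i]]; rewrite mem_iota // => _ ->; exact: nth_prime_prime.
Qed.

Lemma primorial_gt0 k : (0 < primorial k)%N.
Proof.
rewrite /primorial big_add1 big_mkord prodn_gt0 // => i.
exact/prime_gt0/nth_prime_prime.
Qed.

Section RealValued.
Variable R : realType.

(** In each ratio p^l / ((p-1) p^(l-1)) the power p^(l-1) cancels, so multiplicities do not affect
    [f]. *)
Lemma f_prod n : (0 < n)%N ->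
  f R n = \prod_(p <- primes n) (p%:R / p.-1%:R).
Proof.
move=> n0; rewrite /f totientE // {1}[n]prod_prime_decomp // prime_decompE big_map /=.
rewrite !natr_prod -prodf_div !big_seq; apply: eq_bigr => p.
rewrite mem_primes => /and3P[pp _ pn].
have l0 : (0 < logn p n)%N by rewrite logn_gt0 mem_primes pp n0.
rewrite -{1}(prednK l0) expnS !natrM -mulf_div divff ?mulr1 //.
by rewrite pnatr_eq0 -lt0n expn_gt0 prime_gt0.
Qed.

Lemma prime_ratio_ge1 p : prime p -> 1 <= p%:R / p.-1%:R :> R.
Proof.
move=> /prime_gt1; case: p => [|[|p]] //= _.
by rewrite ler_pdivlMr ?ltr0n // mul1r ler_nat.
Qed.

Lemma prime_ratio_anti p r : prime p -> (p <= r)%N ->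
  r%:R / r.-1%:R <= p%:R / p.-1%:R :> R.
Proof.
move=> /prime_gt1; case: p r => [|[|p]] [|[|r]] //= _ pr.
rewrite ler_pdivrMr ?ltr0n // mulrAC ler_pdivlMr ?ltr0n // -!natrM ler_nat.
by rewrite mulSn [leqRHS]mulSn [(p.+1 * _)%N]mulnC leq_add2r.
Qed.

(** The primes of [d] form a sublist of those of [n], and each missing factor p/(p-1) is at least
    1. *)
Lemma f_dvd d n : (0 < n)%N -> (d %| n)%N -> f R d <= f R n.
Proof.
move=> n0 dn; have d0 := dvdn_gt0 n0 dn; rewrite !f_prod //.
have -> : primes d = [seq p <- primes n | (p %| d)%N].
  apply: (irr_sorted_eq ltn_trans ltnn); rewrite ?sorted_primes //.
    exact: (sorted_filter ltn_trans _ (sorted_primes n)).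
  move=> p; rewrite mem_filter !mem_primes n0 d0 /= andbC.
  by case: (boolP (p %| d)%N) => //= pd; rewrite (dvdn_trans pd dn) andbT.
rewrite big_filter big_mkcond /= !big_seq; apply: ler_prod => p.
rewrite mem_primes => /and3P[pp _ _]; have := prime_ratio_ge1 pp.
by case: ifP => _ h; rewrite ?ler01 ?lexx ?h ?(le_trans ler01 h).
Qed.

Lemma s_lt_f n : (2 <= n)%N -> s R n < f R n.
Proof.
move=> n2; have n0 := ltnW n2; have t0 : (0 < totient n)%N by rewrite totient_gt0.
rewrite /s /f ltr_pdivrMr ?ltr0n // mulrAC ltr_pdivlMr ?ltr0n // -!natrM ltr_nat.
have dphi d : (d %| n)%N -> (d * totient n <= n * totient d)%N.
  move=> dn; have := f_dvd n0 dn; have d0 := dvdn_gt0 n0 dn.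
  rewrite /f ler_pdivrMr ?ltr0n ?totient_gt0 // mulrAC ler_pdivlMr ?ltr0n //.
  by rewrite -!natrM ler_nat.
have sumphi : (\sum_(d <- divisors n) totient d = n)%N.
  rewrite -[RHS]sum_totient_dvd -(big_mkord (fun d => d %| n)%N) -[RHS]big_filter.
  apply: perm_big; apply: uniq_perm; rewrite ?divisors_uniq ?filter_uniq ?iota_uniq //.
  move=> d; rewrite mem_filter mem_index_iota -dvdn_divisors //= ltnS.
  by case dn: (d %| n)%N; rewrite //= dvdn_leq.
have d1 : 1%N \in divisors n by rewrite -dvdn_divisors ?dvd1n.
rewrite /sigma big_distrl /= -[X in (_ < n * X)%N]sumphi big_distrr /=.
(* Strictness comes from the divisor 1 alone, whose term reads phi(n) < n; the other divisors only
   need [dphi]. *)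
rewrite (big_rem 1%N) //= [ltnRHS](big_rem 1%N) //= -addSn; apply: leq_add.
  (* Among the residues 0, ..., n-1, the residue 0 is not coprime to [n] since n >= 2, so at most
     n-1 are counted. *)
  rewrite mul1n (_ : totient 1 = 1%N) // muln1 totient_count_coprime big_ltn // /coprime gcdn0.
  rewrite gtn_eqF // add0n -[ltnRHS](prednK n0) ltnS -subn1 -[leqRHS]mul1n.
  by rewrite mulnC -sum_nat_const_nat; apply: leq_sum => i _; exact: leq_b1.
rewrite !big_seq; apply: leq_sum => d /mem_rem; rewrite -dvdn_divisors //.
exact: dphi.
Qed.

Lemma f_le_primorial n : (0 < n)%N -> f R n <= f R (primorial (omega n)).
Proof.
move=> n0; rewrite !f_prod ?primorial_gt0 //.
(* Both products are reindexed by positions from 0 and compared factor by factor, p/(p-1) being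
   decreasing in p. *)
rewrite primes_primorial big_map (iotaDl 1 0) big_map.
rewrite (big_nth 0%N) /omega /index_iota subn0 !big_seq; apply: ler_prod => i.
rewrite mem_iota add0n => /andP[_ il].
have pall : all prime (primes n) by apply/allP => p; rewrite mem_primes => /andP[].
rewrite divr_ge0 //= prime_ratio_anti ?nth_prime_prime //.
exact: nth_prime_le_nth (sorted_primes n) pall il.
Qed.

End RealValued.

Lemma primorial_le_prod k (q : 'I_k -> nat) : (forall i, prime (q i)) ->
  (forall i j : 'I_k, (i < j)%N -> (q i < q j)%N) ->
  (primorial k <= \prod_(i < k) q i)%N.
Proof.
move=> qp qi; rewrite /primorial big_add1 big_mkord; apply: leq_prod => i _.
(* Induction on a bound for [i], because the predecessor must be rebuilt as an element of ['I_k]. *)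
have [m] := ubnP (i : nat); elim: m i => // m IH i; rewrite ltnS => im.
apply: next_prime_le (qp i) => /=.
case: i im => [[|i] ik] im /=; first exact/prime_gt0/qp.
by apply: leq_ltn_trans (IH (Ordinal (ltnW ik)) im) _; exact: qi.
Qed.

Theorem theorem1p4 (R : realType) (n : nat) (q a : 'I_(omega n) -> nat)
    (n_ge2 : (2 <= n)%N)
    (q_prime : forall i, prime (q i))
    (q_incr : forall i j : 'I_(omega n), (i < j)%N -> (q i < q j)%N)
    (a_ge1 : forall i, (1 <= a i)%N)
    (n_fact : n = (\prod_(i < omega n) q i ^ a i)%N)
    (a_large : exists i, Mq R (omega n) (q i) <= (a i)%:R) :
  robin R n.
Proof.
have n0 := ltnW n_ge2; have [i ai] := a_large.
set N := primorial (omega n) in ai *.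
(* One copy of every prime pays for [N]; the surplus copies of [q i] are kept, and those of the
   other primes are discarded. *)
have n_ge : (N * q i ^ (a i).-1 <= n)%N.
  rewrite [leqRHS]n_fact (bigD1 i) //=.
  apply: leq_trans (leq_mul (primorial_le_prod q_prime q_incr) (leqnn _)) _.
  rewrite (bigD1 i) //= mulnAC -expnS prednK // leq_mul2l; apply/orP; right.
  apply: leq_prod => j _; rewrite -{1}[q j]expn1.
  by rewrite leq_pexp2l ?(prime_gt0 (q_prime j)).
have lnq : 0 < ln (q i)%:R :> R by rewrite ln_gt0 // ltr1n prime_gt1.
have ln_ge : expR (expR (- euler_gamma R) * f R N) <= ln n%:R.
  apply: (@le_trans _ _ (ln (N * q i ^ (a i).-1)%N%:R)); last first.
    rewrite ler_ln ?posrE ?ltr0n ?ler_nat //.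
    by rewrite muln_gt0 primorial_gt0 expn_gt0 prime_gt0.
  rewrite natrM natrX lnM ?posrE ?exprn_gt0 ?ltr0n ?primorial_gt0 ?prime_gt0 //.
  (* Moving ln N to the left and dividing by ln q_i > 0 leaves M(k)/ln q_i <= a_i - 1, which is
     [ai]. *)
  rewrite lnXn ?ltr0n ?prime_gt0 // addrC -lerBlDr -[leRHS]mulr_natl -ler_pdivrMr //.
  by rewrite -subn1 natrB // lerBrDl.
apply: lt_le_trans (s_lt_f R n_ge2) _; apply: le_trans (f_le_primorial R n0) _.
(* Here ln n is positive because it dominates an exponential, so a second logarithm preserves the
   inequality. *)
have := ln_ge; rewrite -ler_ln ?posrE ?expR_gt0 ?(lt_le_trans (expR_gt0 _) ln_ge) //.
by rewrite expRK expRN mulrC ler_pdivrMr ?expR_gt0 // mulrC.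
Qed.
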